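(* Fix an integer $k\ge 2$. For every $n$ there exists a pseudo-PI-sequence with $n$ states and $k$ actions per state whose size $m_n$ satisfies $m_n = \frac{k}{k-1}\cdot\frac{k^n}{n} + o\!\left(\frac{k^n}{n}\right)$ as $n\to\infty$.
   Context: Policies are vectors $\pi\in\{1,\dots,k\}^n$ (state $s\in\{1,\dots,n\}$ receives action $\pi(s)$). A collection $U$ of state–action pairs is well-defined if each state appears at most once; then $\pi\oplus U$ is obtained from $\pi$ by setting the action at $s$ to $a$ for each $(s,a)\in U$. A pseudo-PI-sequence of size $m$ is a triple $(\Pi,O,\mathcal{T})$ where: $O$ is a finite sequence of distinct policies, totally ordered by position, with $\pi\prec\pi'$ meaning $\pi$ comes before $\pi'$ in $O$; $\mathcal{T}$ assigns to each policy $\pi$ in $O$ an abstract improvement set $T^\pi$, a set of pairs $(s,a)$ with $a\neq\pi(s)$, and $S^\pi$ denotes the set of states appearing in $T^\pi$; and $\Pi=\pi_0,\pi_1,\dots,\pi_{m-1}$ is a subsequence of $O$ (in the same order). It is required that: (i) for any two policies $\pi\prec\pi'$ in $O$ there is a state $s\in S^\pi$ with $\pi(s)\ne\pi'(s)$ and $(s,\pi(s))\notin T^{\pi'}$; (ii) for each $0\le i<m-1$, $O$ contains at least $|S^{\pi_i}|$ policies $\pi$ with $\pi_i\prec\pi\prec\pi_{i+1}$. *)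

(* Defs.v *)
From mathcomp Require Import all_boot.

Set Implicit Arguments.
Unset Strict Implicit.
Unset Printing Implicit Defensive.

Definition policy (n k : nat) := {ffun 'I_n -> 'I_k}.

Section PseudoPI.
Variables n k : nat.

Definition precedes (O : seq (policy n k)) (p q : policy n k) : bool :=
  [&& p \in O, q \in O & index p O < index q O].

Definition states_of (U : {set 'I_n * 'I_k}) : {set 'I_n} :=
  [set u.1 | u in U].

(* The improvement sets are given by a total function [T] on policies; its
   values outside [O] are irrelevant, since every condition below only concerns
   policies belonging to [O]. *)
Record is_pseudo_PI_sequence (m : nat) (Pi : m.-tuple (policy n k))
    (O : seq (policy n k)) (T : policy n k -> {set 'I_n * 'I_k}) : Prop := {
  order_uniq : uniq O;
  improvement_neq :
    forall (p : policy n k) (s : 'I_n) (a : 'I_k),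
      p \in O -> (s, a) \in T p -> a <> p s;
  sequence_sub : subseq Pi O;
  order_improvement :
    forall p q : policy n k, precedes O p q ->
      exists s : 'I_n,
        [/\ s \in states_of (T p), p s <> q s & (s, p s) \notin T q];
  sequence_gap :
    forall i j : 'I_m, j = i.+1 :> nat ->
      #|states_of (T (tnth Pi i))| <=
        #|[set p | precedes O (tnth Pi i) p && precedes O p (tnth Pi j)]|
}.

End PseudoPI.

(* Main.v *)
(* Let T^p consist of all pairs (s, a) with a > p(s).  Then S^p is the set of
   states where p is not maximal, and condition (i) for p before q only asks for
   a state s with p(s) < q(s), which holds as soon as the policies are listed by
   nondecreasing sum of actions.  The average of |S^p| over all k^n policies is
   q n with q = (k-1)/k, and by Chebyshev's inequality all but a fraction
   1/(d^2 n) of the policies satisfy |S^p| <= (q + d) n.  Take for O these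
   policies only: every g-th element of O, with g about (q + d) n, then gives a
   sequence of size about k^n / ((q + d) n), for every d > 0.  Any prefix of it is
   again admissible, so the size can be capped at k^n / (q n). *)
Require Import Defs.
From mathcomp Require Import all_boot all_order all_algebra.
From mathcomp Require Import all_classical all_reals all_analysis.
From mathcomp Require Import ring lra zify.
Set Implicit Arguments.
Unset Strict Implicit.
Unset Printing Implicit Defensive.
Import Order.TTheory GRing.Theory Num.Theory.
Import numFieldNormedType.Exports.
Local Open Scope classical_set_scope.
Local Open Scope ring_scope.

(** Each block of [g.+1] consecutive integers contributes its first one. Mapped through [nth], this
    turns evenly spaced positions in [O] into a subsequence of [O]. *)
Lemma subseq_iota_multiples (g m : nat) :
  subseq [seq (i * g.+1)%N | i <- iota 0 m] (iota 0 (m * g.+1)).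
Proof.
elim: m => [|m IH] //.
rewrite -[m.+1]addn1 iotaD map_cat mulnDl iotaD !add0n.
by apply: cat_subseq; rewrite // mul1n sub1seq mem_head.
Qed.

(** * The sequence of evenly spaced policies *)

Section Construction.
Variables n k : nat.
Implicit Types p q : policy n k.

Definition action_sum p : nat := (\sum_s p s)%N.

Definition increasing_pairs p : {set 'I_n * 'I_k} := [set u : 'I_n * 'I_k | (p u.1 < u.2)%N].

Definition nonmax_states p : {set 'I_n} := [set s | (p s < k.-1)%N].

Lemma states_of_increasing_pairs p :
  states_of (increasing_pairs p) = nonmax_states p.
Proof.
apply/setP => s; rewrite inE; apply/imsetP/idP => [[[s' a]]|ps].
  by rewrite inE /= => pa ->; have := ltn_ord a; lia.
have k0 : (k.-1 < k)%N by lia.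
by exists (s, Ordinal k0); rewrite ?inE.
Qed.

(** Otherwise [q <= p] at every state, so the sums are equal, and the equality case of the termwise
    comparison forces [p = q]. *)
Lemma action_sum_le_exists p q :
  p != q -> (action_sum p <= action_sum q)%N -> exists s, (p s < q s)%N.
Proof.
move=> pq le_pq; apply: contrapT => /forallNP H.
have qp s : (q s <= p s)%N by rewrite leqNgt; apply/negP/H.
have := leqif_sum (fun s (_ : true) => leqif_eq (qp s)).
move=> -[le_qp]; rewrite eqn_leq le_qp le_pq => /esym/forallP H'.
move/eqP: pq; apply; apply/ffunP => s.
by have /= /eqP/val_inj := H' s.
Qed.

Definition ordered_policies (g : nat) : seq (policy n k) :=
  sort (relpre action_sum leq)
    (enum [pred p : policy n k | (#|nonmax_states p| <= g)%N]).

Lemma mem_ordered_policies g p :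
  (p \in ordered_policies g) = (#|nonmax_states p| <= g)%N.
Proof. by rewrite mem_sort mem_enum inE. Qed.

Lemma ordered_policies_uniq g : uniq (ordered_policies g).
Proof. by rewrite sort_uniq enum_uniq. Qed.

Lemma size_ordered_policies g :
  size (ordered_policies g) =
    #|[pred p : policy n k | (#|nonmax_states p| <= g)%N]|.
Proof. by rewrite size_sort -cardE. Qed.

Lemma precedes_exists_lt g p q :
  precedes (ordered_policies g) p q -> exists s, (p s < q s)%N.
Proof.
case/and3P => pO qO pq; apply: action_sum_le_exists.
  by apply: contraTneq pq => ->; rewrite ltnn.
have tr : transitive (relpre action_sum leq) by move=> ? ? ?; exact: leq_trans.
have srt : sorted (relpre action_sum leq) (ordered_policies g).
  by apply: sort_sorted => ? ?; exact: leq_total.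
exact: (sorted_ltn_index tr srt).
Qed.

Definition pseudo_PI_size (m : nat) : Prop :=
  exists (Pi : m.-tuple (policy n k)) (O : seq (policy n k))
         (T : policy n k -> {set 'I_n * 'I_k}),
    is_pseudo_PI_sequence Pi O T.

(** The chosen policies sit at positions [i * g.+1], so exactly [g] entries separate neighbours, and
    no policy of [O] has more than [g] non-maximal states. *)
Lemma pseudo_PI_size_multiples g m :
  (0 < k)%N -> (m * g.+1 <= size (ordered_policies g))%N -> pseudo_PI_size m.
Proof.
move=> k0 mO; set O := ordered_policies g in mO.
pose p0 : policy n k := [ffun=> Ordinal k0].
have UO : uniq O := ordered_policies_uniq g.
pose Pi := [tuple nth p0 O (i * g.+1)%N | i < m].
have ltO (i : 'I_m) j : (j <= g)%N -> (i * g.+1 + j < size O)%N.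
  move=> jg; apply: leq_trans mO.
  apply: (@leq_trans (i.+1 * g.+1)); last by rewrite leq_mul2r ltn_ord orbT.
  by rewrite mulSn addnC -addSn leq_add2r.
have Pi_in (i : 'I_m) : tnth Pi i \in O.
  by rewrite tnth_mktuple mem_nth // -[X in (X < _)%N]addn0 ltO.
exists Pi, O, increasing_pairs; split => //.
- by move=> p s a _; rewrite inE /= => + ap; rewrite ap ltnn.
- rewrite -(mkseq_nth p0 O) /mkseq.
  have -> : (Pi : seq _) = map (nth p0 O) [seq (i * g.+1)%N | i <- iota 0 m].
    by rewrite /= -val_enum_ord -!map_comp.
  apply/map_subseq/(subseq_trans (subseq_iota_multiples g m)).
  by rewrite -(subnKC mO) iotaD prefix_subseq.
- move=> p q /precedes_exists_lt [s ps]; exists s; split.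
  + rewrite states_of_increasing_pairs inE.
    by have := ltn_ord (q s); lia.
  + by move=> e; rewrite e ltnn in ps.
  + by rewrite inE /= -leqNgt ltnW.
- move=> i j ij; rewrite states_of_increasing_pairs.
  have := Pi_in i; rewrite mem_ordered_policies => /leq_trans; apply.
  (* The shift [l.+1] runs from 1 to [g], hence strictly between the positions of the two chosen
     policies. *)
  pose f (l : 'I_g) := nth p0 O (i * g.+1 + l.+1)%N.
  have f_inj : injective f.
    move=> a b /eqP; rewrite nth_uniq ?ltO // eqn_add2l eqSS => /eqP.
    exact: val_inj.
  rewrite -[X in (X <= _)%N]card_ord -(card_imset predT f_inj).
  apply/subset_leq_card/fintype.subsetP => _ /imsetP[l _ ->].
  have jS : (j * g.+1 < size O)%N by rewrite -[X in (X < _)%N]addn0 ltO.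
  have iS : (i * g.+1 < size O)%N by rewrite -[X in (X < _)%N]addn0 ltO.
  have lS := ltO i l.+1 (ltn_ord l).
  rewrite inE /precedes !Pi_in mem_nth //= !tnth_mktuple !index_uniq //.
  by rewrite ij mulSn; have := ltn_ord l; lia.
Qed.

Lemma pseudo_PI_size0 : (0 < k)%N -> pseudo_PI_size 0.
Proof. by move=> k0; apply: (@pseudo_PI_size_multiples 0). Qed.

End Construction.

(** * Concentration of the number of non-maximal states *)

Section SecondMoment.
Variables (R : realType) (n k : nat).
Hypothesis k_ge2 : (2 <= k)%N.
Implicit Types p : policy n k.

Let q : R := 1 - k%:R^-1.
Let X (a : 'I_k) : R := (a < k.-1)%:R - q.

Let k_gt0 : 0 < k%:R :> R.
Proof. by rewrite ltr0n; lia. Qed.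

Lemma sum_centered_indicator : \sum_a X a = 0.
Proof.
rewrite sumrB sumr_const card_ord /q.
(* With [k = k'.+1], the last action is the only one whose indicator vanishes. *)
case: k k_ge2 k_gt0 => // k' _ k0.
rewrite big_ord_recr /= ltnn addr0 (eq_bigr (fun=> 1)) => [|i _]; last by rewrite ltn_ord.
rewrite sumr_const card_ord -[(1 - _) *+ _]mulr_natr mulrBl mul1r mulVf ?gt_eqF//.
rewrite -natr1; ring.
Qed.

Lemma centered_indicator_sqr_le1 a : X a ^+ 2 <= 1.
Proof.
have k1 : 1 <= k%:R :> R by rewrite ler1n; lia.
have i0 : 0 < k%:R^-1 :> R by rewrite invr_gt0.
have i1 : k%:R^-1 <= 1 :> R by rewrite invf_le1.
by rewrite /X /q; case: (_ < _)%N => /=; nra.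
Qed.

(** Distinct coordinates of a uniform policy are independent, and each [X (p s)] has mean zero. *)
Lemma sum_cross_terms (s t : 'I_n) :
  s != t -> \sum_(p : policy n k) X (p s) * X (p t) = 0.
Proof.
move=> st.
(* Padding by 1 at the other states gives a product over all states, so the sum over policies
   factors into a product of sums over actions; the factor at [s] is zero. *)
pose F u a := (if u == s then X a else 1) * (if u == t then X a else 1).
transitivity (\sum_(p : policy n k) \prod_u F u (p u)).
  apply: eq_bigr => p _; rewrite big_split /= -!big_mkcond /=.
  by rewrite !big_pred1_eq.
rewrite -(bigA_distr_bigA F) (bigD1 s) //= [X in X * _](_ : _ = 0) ?mul0r//.
rewrite -[RHS]sum_centered_indicator; apply: eq_bigr => a _.
by rewrite /F eqxx (negbTE st) mulr1.
Qed.

Lemma card_nonmax_states_centered p :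
  #|nonmax_states p|%:R - q * n%:R = \sum_s X (p s).
Proof.
rewrite sumrB sumr_const card_ord mulr_natr; congr (_ - _).
rewrite -sum1_card natr_sum big_mkcond /=; apply: eq_bigr => s _.
by rewrite inE; case: ifP.
Qed.

(** After expanding the square, only the [n] diagonal terms survive, each at most 1 per policy. *)
Lemma second_moment_nonmax_states :
  \sum_(p : policy n k) (#|nonmax_states p|%:R - q * n%:R) ^+ 2
    <= (k ^ n)%:R * n%:R.
Proof.
under eq_bigr => p _.
  rewrite card_nonmax_states_centered expr2 big_distrlr /=; over.
rewrite exchange_big /=.
under eq_bigr => s _ do rewrite exchange_big /=.
apply: (@le_trans _ _ (\sum_(s < n) (k ^ n)%:R)); last first.
  by rewrite sumr_const card_ord mulr_natr.
apply: ler_sum => s _.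
rewrite (bigD1 s) //= [X in _ + X]big1 ?addr0; last first.
  by move=> t ts; apply: sum_cross_terms; rewrite eq_sym.
apply: (@le_trans _ _ (\sum_(p : policy n k) 1)).
  by apply: ler_sum => p _; rewrite -expr2 centered_indicator_sqr_le1.
by rewrite sumr_const card_ffun !card_ord.
Qed.

(** A policy left out of the list has at least [g.+1] non-maximal states, so it deviates from the
    mean by more than [d * n] and adds at least [(d * n) ^ 2] to the second moment. *)
Lemma chebyshev_nonmax_states (d : R) (g : nat) :
  0 < d -> (0 < n)%N -> (q + d) * n%:R < g.+1%:R ->
  (k ^ n)%:R * (1 - (d ^+ 2 * n%:R)^-1) <= (size (ordered_policies n k g))%:R.
Proof.
move=> d0 n0 hg.
have n0' : 0 < n%:R :> R by rewrite ltr0n.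
rewrite size_ordered_policies.
set A := [pred p | _]; have := cardC A; rewrite card_ffun !card_ord => cA.
have dn0 : 0 < d ^+ 2 * n%:R by rewrite mulr_gt0 ?exprn_gt0.
rewrite mulrBr mulr1 lerBlDr -[X in X%:R <= _]cA natrD lerD2l ler_pdivlMr//.
rewrite -(ler_pM2r n0'); apply: le_trans second_moment_nonmax_states.
rewrite (bigID (mem A)) /= -[leLHS]add0r; apply: lerD.
  by apply: sumr_ge0 => p _; exact: sqr_ge0.
have -> : #|[predC A]|%:R * (d ^+ 2 * n%:R) * n%:R =
          \sum_(p in [predC A]) (d * n%:R) ^+ 2.
  by rewrite sumr_const -[RHS]mulr_natl; ring.
apply: ler_sum => p; rewrite !inE -ltnNge => gp.
have gp' : g.+1%:R <= #|nonmax_states p|%:R :> R by rewrite ler_nat.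
rewrite lerXn2r// ?nnegrE; nra.
Qed.

End SecondMoment.

(** * Quantitative lower bound on the size, and the limit *)

Lemma sqr_le_expn (n k : nat) : (2 <= k)%N -> (4 <= n)%N -> (n ^ 2 <= k ^ n)%N.
Proof.
move=> k2 n4; apply: (@leq_trans (2 ^ n)); last by rewrite leq_exp2r; lia.
elim: n n4 => // n IH; rewrite leq_eqVlt => /predU1P[<-//|n4].
by have := IH n4; rewrite (expnS 2 n); nia.
Qed.

(** Here [m] is the cap, the integer part of the target. The bound on [d ^+ 3 * n] makes the
    Chebyshev loss [1 / (d ^ 2 * n)] at most [d]. Of the total loss [11 * d], a part [10 * d] comes
    from Chebyshev and the spacing, and [d] from rounding the size down. *)
Lemma pseudo_PI_size_lower (R : realType) (n k m : nat) (d : R) :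
  (2 <= k)%N -> (4 <= n)%N -> 0 < d <= 1 -> 1 <= d ^+ 3 * n%:R ->
  let A := k%:R ^+ n / n%:R in
  m%:R <= (1 - k%:R^-1)^-1 * A ->
  (1 - k%:R^-1)^-1 * A < m.+1%:R ->
  exists2 m', pseudo_PI_size n k m' /\ (m' <= m)%N &
    ((1 - k%:R^-1)^-1 - 11 * d) * A <= m'%:R.
Proof.
move=> k2 n4 /andP[d0 d1] dn A mA Am.
set q : R := 1 - k%:R^-1 in mA Am *.
have q_ge : 1 / 2 <= q.
  have : (k%:R : R)^-1 <= 2^-1 by rewrite lef_pV2 ?posrE ?ltr0n ?ler_nat; lia.
  by rewrite /q; lra.
have n0 : (0 < n)%N by exact: leq_trans n4.
have k0 : (0 < k)%N by exact: ltnW.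
have n_gt0 : 0 < n%:R :> R by rewrite ltr0n.
have n1 : 1 <= d * n%:R.
  apply: (le_trans dn); rewrite ler_pM2r// exprS -[leRHS]mulr1 ler_pM2l//.
  by rewrite exprn_ile1// ltW.
have A_ge : n%:R <= A.
  by rewrite /A ler_pdivlMr// -expr2 -!natrX ler_nat sqr_le_expn.
have A_gt0 : 0 < A := lt_le_trans n_gt0 A_ge.
have dA : 1 <= d * A by apply: (le_trans n1); rewrite ler_pM2l.
pose g := Num.truncn ((q + d) * n%:R).
have qd0 : 0 <= (q + d) * n%:R by rewrite mulr_ge0; lra.
(* The second [d] pays for the successor, since [1 <= d * n]. *)
have gU : g.+1%:R <= (q + 2 * d) * n%:R.
  have : g%:R <= (q + d) * n%:R by rewrite truncn_le.
  by rewrite -natr1; lra.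
have gL : (q + d) * n%:R < g.+1%:R by exact: truncnS_gt.
set S := size (ordered_policies n k g).
have SL : k%:R ^+ n * (1 - d) <= S%:R.
  apply: le_trans (chebyshev_nonmax_states k2 d0 n0 gL).
  rewrite natrX ler_pM2l ?exprn_gt0 ?ltr0n//.
  rewrite lerB// invf_ple ?posrE ?mulr_gt0 ?exprn_gt0//.
  by rewrite -[leLHS]mul1r ler_pdivrMr//; move: dn; rewrite exprS; lra.
pose m' := (S %/ g.+1)%N.
exists (minn m m').
  split; last exact: geq_minl.
  apply: (@pseudo_PI_size_multiples n k g) => //.
  by apply: leq_trans (leq_divM _ g.+1); rewrite leq_mul2r geq_minr orbT.
(* If the cap [m] is the minimum, only its rounding is lost, and [1 <= d * A] absorbs it. *)
rewrite /minn; case: ifP => _.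
  apply: (@le_trans _ _ (q^-1 * A - d * A)); last by rewrite -natr1 in Am; lra.
  by rewrite mulrBl lerB// ler_pM2r//; lra.
have Sm : S%:R <= m'.+1%:R * g.+1%:R :> R.
  by rewrite -natrM ler_nat ltnW// ltn_ceil.
have key : A * (1 - d) <= (m'%:R + d * A) * (q + 2 * d).
  rewrite -(ler_pM2r n_gt0).
  apply: (@le_trans _ _ S%:R).
    by rewrite mulrAC /A divfK ?gt_eqF.
  apply: (le_trans Sm); rewrite -mulrA ler_pM//.
  by rewrite -natr1 lerD2l.
(* The constant 10 suffices because [q >= 1 / 2] gives [10 * q ^ 2 >= 5 * q >= q + 2]. *)
have qi : (q^-1 - 10 * d) * (q + 2 * d) <= 1 - d.
  have -> : (q^-1 - 10 * d) * (q + 2 * d) =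
    1 + d * (2 - 10 * q * q - 20 * d * q) * q^-1 by field; rewrite gt_eqF; lra.
  have : d * (2 - 10 * q * q - 20 * d * q) * q^-1 <= - d; last by lra.
  by rewrite ler_pdivrMr ?mulNr -?mulrN ?ler_pM2l; nra.
have : (q^-1 - 10 * d) * A <= m'%:R + d * A; last by lra.
have qd : 0 < q + 2 * d by lra.
rewrite -(ler_pM2r qd); apply: le_trans key.
by rewrite mulrAC mulrC ler_pM2l.
Qed.

Theorem theorem2 (R : realType) (k : nat) (hk : (2 <= k)%N) :
  exists m : nat -> nat,
    (forall n : nat,
       exists (Pi : (m n).-tuple (policy n k)) (O : seq (policy n k))
              (T : policy n k -> {set 'I_n * 'I_k}),
         is_pseudo_PI_sequence Pi O T) /\
    (fun n : nat => (m n)%:R : R) =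
      (fun n : nat => k%:R / (k%:R - 1) * (k%:R ^+ n / n%:R) : R)
        +o_\oo (fun n : nat => k%:R ^+ n / n%:R : R).
Proof.
have k0 : 0 < k%:R :> R by rewrite ltr0n; lia.
have k1 : 1 < k%:R :> R by rewrite ltr1n.
have kq : k%:R / (k%:R - 1) = (1 - k%:R^-1)^-1 :> R.
  have k1' : k%:R - 1 != 0 :> R by rewrite gt_eqF; lra.
  by field; rewrite k1' gt_eqF.
pose A n : R := k%:R ^+ n / n%:R.
pose U n := Num.truncn ((1 - k%:R^-1)^-1 * A n).
have c0 : 0 < (1 - k%:R^-1)^-1 :> R.
  by rewrite -kq divr_gt0//; lra.
have A0 n : 0 <= A n by rewrite /A divr_ge0 ?exprn_ge0.
(* Taking the largest admissible size below the cap makes [m] independent of the tolerance [e],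
   while it still dominates the size built for each [d]. The default value 0 of the maximum is
   itself admissible. *)
pose m n := (\max_(i < (U n).+1 | `[< pseudo_PI_size n k i >]) i)%N.
exists m; split.
  move=> n; rewrite -/(pseudo_PI_size n k (m n)) /m.
  elim/big_ind: _ => [|x y|i /asboolP//]; first by apply: pseudo_PI_size0; lia.
  by rewrite /maxn; case: ifP.
apply/eqaddoP => e e0; rewrite kq.
(* Chosen so that the loss [11 * d] is at most [e]. *)
pose d := Num.min 1 (e / 11).
have d0 : 0 < d by rewrite lt_min ltr01 divr_gt0.
have d1 : d <= 1 by rewrite ge_min lexx.
have de : 11 * d <= e.
  by have : d <= e / 11; [rewrite ge_min lexx orbT | lra].
near=> n.
have n4 : (4 <= n)%N by near: n; exact: nbhs_infty_ge.
have dn : 1 <= d ^+ 3 * n%:R.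
  rewrite mulrC -ler_pdivrMr ?exprn_gt0//.
  by near: n; exact: nbhs_infty_ger.
have UA : (U n)%:R <= (1 - k%:R^-1)^-1 * A n by rewrite truncn_le mulr_ge0// ltW.
have AU : (1 - k%:R^-1)^-1 * A n < (U n).+1%:R by exact: truncnS_gt.
have d01 : 0 < d <= 1 by rewrite d0.
have [m' [vm' m'U] m'_ge] := pseudo_PI_size_lower hk n4 d01 dn UA AU.
have m'm : (m' <= m n)%N.
  by rewrite -ltnS in m'U; apply: (@leq_bigmax_cond _ _ _ (Ordinal m'U)); exact/asboolP.
have mU : (m n <= U n)%N.
  by apply/bigmax_leqP => i _; rewrite -ltnS.
rewrite /= -/(A n) (ger0_norm (A0 n)).
have mU' : (m n)%:R <= (U n)%:R :> R by rewrite ler_nat.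
have m'm' : m'%:R <= (m n)%:R :> R by rewrite ler_nat.
have deA : 11 * d * A n <= e * A n by rewrite ler_wpM2r.
change (`|(m n)%:R - (1 - k%:R^-1)^-1 * A n| <= e * A n).
rewrite -/(A n) in m'_ge.
rewrite ler_norml; move: UA m'_ge; rewrite mulrBl; lra.
Unshelve. all: by end_near.
Qed.
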